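(* Let $G$ be a tidy $(H,\mathcal P)$-graph such that $\textnormal{tww}(G)\ge 3$ and all paths in $\mathcal P$ have length at least $3\cdot f_H(2|V(H)|^2)+9$, and let $G'$ be any trigraph obtained from $G$ by shortening paths in $\mathcal P$ (by contracting consecutive vertices) to arbitrary lengths no shorter than $3\cdot f_H(2|V(H)|^2)+9$. Then $\textnormal{tww}(G')\le \textnormal{tww}(G)+1$.
   Context: $f_H:\mathbb N\to\mathbb N$ is defined by $f_H(\ell)=(3^{|V(H)|+4}\cdot|V(H)|^2)^{\ell}$. A trigraph has edges partitioned into black and red edges. Contracting two distinct vertices $u,v$ replaces them by a new vertex $w$ joined by a black edge to each vertex joined to both by black edges and by a red edge to every other vertex adjacent to $u$ or $v$. A contraction sequence of $G$ contracts repeatedly until one vertex remains; its width is the maximum red degree appearing; $\textnormal{tww}(G)$ is the minimum width. The length of a path is its number of edges. Stumps: a vertex $u$ has a half stump $v$ if $uv$ is black and $\deg v=1$; a red (resp. black) stump $vw$ if $uv$ is black, $vw$ is red (resp. black), $\deg v=2$, $\deg w=1$. A dangling pseudo-path is an induced subtrigraph obtained from a path $P$ whose vertices have degree $2$ apart from their stumps by adding to each vertex of $P$ either one red stump or at most one black stump and at most one half stump. An $(H,\mathcal P)$-graph is a connected trigraph $G$ with $\textnormal{tww}(G)\ge 2$ whose vertices are partitioned into an induced subtrigraph $H$ and the disjoint union $\sqcup\mathcal P$ of a set $\mathcal P$ of dangling pseudo-paths. A connector is a vertex of $H$ adjacent to a vertex of $\sqcup\mathcal P$. A path $P\in\mathcal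 P$ is tidy if all its edges are red and its vertices have degree $2$ in $G$ (no stumps), and for each connector $u$ adjacent to an endpoint $v$ of $P$: (1) $u$ has black degree $0$; (2) $v$ is the only neighbour of $u$ in $\sqcup\mathcal P$; (3) $u$ has a unique neighbour $u'$ in $V(H)$ and $u'$ has positive black degree. The $(H,\mathcal P)$-graph is tidy if all paths in $\mathcal P$ are tidy. *)

(* Defs.v *)
From HB Require Import structures.
From mathcomp Require Import all_boot.
From mathcomp Require Import boolp.

Set Implicit Arguments.
Unset Strict Implicit.
Unset Printing Implicit Defensive.

Record trigraph := Trigraph {
  vertex :> finType;
  black : rel vertex;
  red : rel vertex;
  black_sym : symmetric black;
  black_irr : irreflexive black;
  red_sym : symmetric red;
  red_irr : irreflexive red;
  black_red : forall x y, ~~ (black x y && red x y) }.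

Section Basics.
Variable G : trigraph.
Implicit Types u v w : G.

Definition adj u v : bool := black u v || red u v.

Definition deg u : nat := #|[set v | adj u v]|.
Definition black_deg u : nat := #|[set v | black u v]|.
Definition red_deg u : nat := #|[set v | red u v]|.

Definition max_red_deg : nat := \max_(u : G) red_deg u.

Definition connected : Prop :=
  0 < #|G| /\ forall u v, connect adj u v.

End Basics.

Section Contraction.
Variables (G : trigraph) (u v : G).

(* [None] is the new vertex. *)
Definition contract_vertex : finType :=
  option {x : G | (x != u) && (x != v)}.

Definition contract_black (a b : contract_vertex) : bool :=
  match a, b with
  | Some x, Some y => black (val x) (val y)
  | None, Some y | Some y, None => black u (val y) && black v (val y)
  | None, None => false
  end.

Definition contract_red (a b : contract_vertex) : bool :=
  match a, b with
  | Some x, Some y => red (val x) (val y)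
  | None, Some y | Some y, None =>
      (adj u (val y) || adj v (val y))
      && ~~ (black u (val y) && black v (val y))
  | None, None => false
  end.

Lemma contract_black_sym : symmetric contract_black.
Proof. by case=> [x|] [y|] //=; rewrite black_sym. Qed.

Lemma contract_black_irr : irreflexive contract_black.
Proof. by case=> [x|] //=; rewrite black_irr. Qed.

Lemma contract_red_sym : symmetric contract_red.
Proof. by case=> [x|] [y|] //=; rewrite red_sym. Qed.

Lemma contract_red_irr : irreflexive contract_red.
Proof. by case=> [x|] //=; rewrite red_irr. Qed.

Lemma contract_black_red a b : ~~ (contract_black a b && contract_red a b).
Proof.
case: a b => [x|] [y|] //=; first exact: black_red.
all: by case: (black u _ && black v _); rewrite ?andbF.
Qed.

Definition contract : trigraph :=
  Trigraph contract_black_sym contract_black_irr contract_red_sym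
    contract_red_irr contract_black_red.

(* Sends [u] and [v] to the new vertex and any other vertex to itself. *)
Definition contract_proj (x : G) : contract := insub x.

Lemma card_contract : u != v -> #|contract| = #|G|.-1.
Proof.
move=> uv; rewrite card_option card_sig.
have -> : #|[pred x | (x != u) && (x != v)]| = #|~: [set u; v]|.
  by apply: eq_card => x; rewrite !inE negb_or.
rewrite -(cardsC [set u; v]) cards2 uv.
by [].
Qed.

End Contraction.

Inductive contraction_seq : trigraph -> Type :=
| ContractionEnd (G : trigraph) : #|G| = 1 -> contraction_seq G
| ContractionStep (G : trigraph) (u v : G) :
    u != v -> contraction_seq (contract u v) -> contraction_seq G.

Fixpoint width G (s : contraction_seq G) : nat :=
  match s with
  | ContractionEnd G _ => max_red_deg G
  | ContractionStep G _ _ _ s' => maxn (max_red_deg G) (width s')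
  end.

(* The value is 0 for the empty trigraph, which has no contraction sequence;
   [tww_spec] characterises the value for every other trigraph. *)
Definition tww (G : trigraph) : nat :=
  match pselect (exists k, `[< exists s : contraction_seq G, width s = k >])
  with
  | left ex_width => ex_minn ex_width
  | right _ => 0
  end.

Lemma contraction_seq_exists (G : trigraph) :
  0 < #|G| -> inhabited (contraction_seq G).
Proof.
have [n] := ubnP #|G|; elim: n G => // n IHn G leGn G_gt0.
have [G1|Gn1] := eqVneq #|G| 1; first exact: inhabits (ContractionEnd G1).
have G_gt1 : 1 < #|G| by rewrite ltn_neqAle eq_sym Gn1.
have /card_gt1P [u [v [_ _ uv]]] := G_gt1.
have [||s] := IHn (contract u v).
- by rewrite card_contract // prednK // -ltnS.
- by rewrite card_contract // -ltnS prednK.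
- exact: inhabits (ContractionStep uv s).
Qed.

Lemma tww_spec (G : trigraph) : 0 < #|G| ->
  (exists s : contraction_seq G, width s = tww G) /\
  forall s : contraction_seq G, tww G <= width s.
Proof.
move=> /contraction_seq_exists[s0]; rewrite /tww; case: pselect => [ex|[]].
  case: ex_minnP => k /asboolP exk mink; split=> // s.
  by apply: mink; apply/asboolP; exists s.
by exists (width s0); apply/asboolP; exists s0.
Qed.

Section PseudoPaths.
Variable G : trigraph.
Implicit Types (u v w x y : G) (s p : seq G) (X Y H : {set G}).
Implicit Types P : {set {set G}}.

Definition induced_path s : Prop :=
  uniq s /\
  {in s &, forall x y, adj x y = (index y s == (index x s).+1)
                              || (index x s == (index y s).+1)}.

Definition half_stump u v : bool := black u v && (deg v == 1).

Definition red_stump u v w : bool :=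
  [&& black u v, red v w, deg v == 2 & deg w == 1].

Definition black_stump u v w : bool :=
  [&& w != u, black u v, black v w, deg v == 2 & deg w == 1].

(* The stumps of [u] all of whose vertices lie in [S]. *)
Definition half_stumps (S : {set G}) u : {set G} := [set v in S | half_stump u v].
Definition red_stumps (S : {set G}) u : {set G * G} :=
  [set e | [&& e.1 \in S, e.2 \in S & red_stump u e.1 e.2]].
Definition black_stumps (S : {set G}) u : {set G * G} :=
  [set e | [&& e.1 \in S, e.2 \in S & black_stump u e.1 e.2]].

(* Pseudo-paths, being induced subtrigraphs, are given by their vertex sets;
   [s] is the underlying path and [S] the set of vertices of the stumps. *)
Definition dangling_pseudo_path X : Prop :=
  exists s (S : {set G}),
  [/\ s != [::] /\ induced_path s,
      X = [set x in s] :|: S /\ [disjoint [set x in s] & S],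
      {in s, forall u, #|[set v | adj u v] :\: S| = 2},
      {in s, forall u,
         [/\ #|red_stumps S u| = 1, #|black_stumps S u| = 0
           & #|half_stumps S u| = 0]
         \/
         [/\ #|red_stumps S u| = 0, #|black_stumps S u| <= 1
           & #|half_stumps S u| <= 1]}
    & {in S, forall y, exists2 u, u \in s &
         [\/ y \in half_stumps S u,
             exists2 e, e \in red_stumps S u & (y == e.1) || (y == e.2)
           | exists2 e, e \in black_stumps S u & (y == e.1) || (y == e.2)]}].

(* The last condition expresses that the subtrigraph induced by [cover P] is
   the disjoint union of the members of [P]. *)
Definition HP_graph H P : Prop :=
  [/\ connected G,
      2 <= tww G,
      H :|: cover P = setT /\ [disjoint H & cover P],
      {in P, forall X, dangling_pseudo_path X}
    & trivIset P /\
      {in P &, forall X Y, X != Y ->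
         {in X & Y, forall x y, ~~ adj x y}}].

Definition connector H P u : Prop :=
  u \in H /\ exists2 v, v \in cover P & adj u v.

Definition tidy_path H P X : Prop :=
  exists x p,
  [/\ induced_path (x :: p),
      X = [set y in x :: p],
      {in X &, forall y z, adj y z -> red y z},
      {in X, forall y, deg y = 2}
    & forall u v, connector H P u -> v \in [:: x; last x p] -> adj u v ->
      [/\ black_deg u = 0,
          [set y in cover P | adj u y] = [set v]
        & exists2 u', [set y in H | adj u y] = [set u'] & 0 < black_deg u']].

Definition tidy_HP_graph H P : Prop :=
  HP_graph H P /\ {in P, forall X, tidy_path H P X}.

(* For a path without stumps, given by its vertex set. *)
Definition path_length X : nat := #|X|.-1.

Definition fH H (l : nat) : nat := (3 ^ (#|H| + 4) * #|H| ^ 2) ^ l.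

Definition min_length H : nat := 3 * fH H (2 * #|H| ^ 2) + 9.

End PseudoPaths.

(* [shortening P' P]: the trigraph of [P'] arises from that of [P] by
   successively contracting two consecutive vertices of a path, and [P'] is the
   resulting family of paths. A path is given by its vertex set and is induced,
   so its consecutive vertices are its adjacent ones. *)
Inductive shortening (G' : trigraph) (P' : {set {set G'}}) :
    forall G : trigraph, {set {set G}} -> Prop :=
| ShorteningRefl : shortening P' P'
| ShorteningStep (G : trigraph) (P : {set {set G}}) (X : {set G}) (u v : G) :
    X \in P -> u \in X -> v \in X -> adj u v ->
    shortening P' [set contract_proj u v @: (Y : {set G}) | Y in P] ->
    shortening P' P.

(* Main.v *)
(* Let t = tww G.  The core C is H without its connectors; being induced in G it
   has a contraction sequence of width at most t, and G' consists of C and of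
     red
   "ears", each a path of G' together with its two connectors.
   Make C redder by adding a red path, the bus, with one vertex attached to each
   vertex of C, in an order in which every part of every partition of the
   sequence of C is an interval.  Then C with its bus has twin-width at most
   t + 1: before two parts are merged, their consecutive bus vertices are
     merged,
   at the price of a bus vertex of red degree 4 <= t + 1, and every part has
     only
   one more red neighbour than in C.
   An ear with at least |C| vertices can be zipped into the bus vertex by
     vertex,
   walking along the bus from the position of one end to that of the other; this
   again creates red degree at most 4 on the bus.  As the twin-width does not
   decrease when a trigraph is enlarged or made redder, tww G' <= t + 1. *)
Require Import Defs.
From mathcomp Require Import all_boot.
From mathcomp Require Import zify.
From mathcomp Require boolp.

Set Implicit Arguments.
Unset Strict Implicit.
Unset Printing Implicit Defensive.

(** * Twin-width under reddening and enlarging *)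

Definition tww_atmost (k : nat) (G : trigraph) : Prop :=
  exists s : contraction_seq G, width s <= k.

Lemma tww_atmostP k (G : trigraph) : 0 < #|G| -> tww_atmost k G <-> tww G <= k.
Proof.
move=> G_gt0; have [[s sE] mins] := tww_spec G_gt0; split=> [[s' s'k]|Gk].
  exact: leq_trans (mins s') s'k.
by exists s; rewrite sE.
Qed.

Lemma max_red_deg_width (G : trigraph) (s : contraction_seq G) :
  max_red_deg G <= width s.
Proof. by case: s => //= {}G u v uv s; exact: leq_maxl. Qed.

Lemma max_red_deg_leP (G : trigraph) k :
  (forall x : G, red_deg x <= k) -> max_red_deg G <= k.
Proof. by move=> Gk; apply/bigmax_leqP. Qed.

(* Up to the identifications made by [g], [K] is redder than [G]. *)
Definition compat (G K : trigraph) (g : G -> K) : Prop :=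
  (forall x y, adj x y -> g x = g y \/ adj (g x) (g y)) /\
  (forall x y, black (g x) (g y) -> black x y).

Lemma adj_sym (G : trigraph) : symmetric (@adj G).
Proof. by move=> x y; rewrite /adj black_sym red_sym. Qed.

Lemma adj_irr (G : trigraph) : irreflexive (@adj G).
Proof. by move=> x; rewrite /adj black_irr red_irr. Qed.

Lemma compat_comp (G K L : trigraph) (g : G -> K) (f : K -> L) :
  compat g -> compat f -> compat (f \o g).
Proof.
move=> [ga gb] [fa fb]; split=> x y /=.
  by case/ga=> [->|/fa //]; left.
by move=> /fb/gb.
Qed.

Lemma contract_projP (G : trigraph) (u v x : G) :
  (x = u \/ x = v) /\ contract_proj u v x = None \/
  exists2 z : {x : G | (x != u) && (x != v)},
    val z = x & contract_proj u v x = Some z.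
Proof.
rewrite /contract_proj; case: insubP => [z _ zx|]; first by right; exists z.
rewrite negb_and !negbK => xuv; left; split=> //.
by case/orP: xuv => /eqP; [left|right].
Qed.

Lemma adj_contract_None (G : trigraph) (u v : G) y :
  @adj (contract u v) None (Some y) = adj u (val y) || adj v (val y).
Proof.
rewrite {1}/adj /= orb_andr orbN andbT /adj.
by case: (black u _); case: (black v _); rewrite ?orbT.
Qed.

Lemma compat_contract_proj (G : trigraph) (u v : G) :
  compat (contract_proj u v).
Proof.
split=> x y; case: (contract_projP u v x) => [[xuv ->]|[z <- ->]];
  case: (contract_projP u v y) => [[yuv ->]|[w <- ->]] //=.
- by left.
- move=> xy; right; rewrite adj_contract_None.
  by case: xuv xy => -> ->; rewrite ?orbT.
- move=> xy; right; rewrite adj_sym adj_contract_None.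
  by case: yuv xy => ->; rewrite adj_sym => ->; rewrite ?orbT.
- by right.
- by case/andP=> ux vx; case: xuv => ->.
- by case/andP=> ux vx; case: yuv => ->; rewrite black_sym.
Qed.

Definition contract_lift (G K : trigraph) (g : G -> K) (u v : G)
  (a : contract u v) : K := if a is Some z then g (val z) else g u.

(** A black edge at the new vertex needs black edges at both [u] and [v], and a compatible [g] with
    [g u = g v] reflects a black edge to both of them; so [g] factors through the contraction. *)
Lemma compat_contract_lift (G K : trigraph) (g : G -> K) (u v : G) :
  compat g -> g u = g v -> compat (@contract_lift G K g u v).
Proof.
move=> [ga gb] guv; split=> [[x|] [y|]|[x|] [y|]] //=; rewrite ?black_irr //.
- exact: ga.
- rewrite adj_sym adj_contract_None => /orP[]/ga.
    by case=> [->|h]; [left|right; rewrite adj_sym].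
  by rewrite -guv; case=> [->|h]; [left|right; rewrite adj_sym].
- rewrite adj_contract_None => /orP[]/ga //.
  by rewrite -guv.
- exact: gb.
- by rewrite black_sym => h; rewrite (gb _ _ h) gb // -guv.
- by move=> h; rewrite (gb _ _ h) gb // -guv.
Qed.

(** The degenerate case [u = v] is allowed and means injectivity. *)
Definition collapses_only (S T : Type) (g : S -> T) (u v : S) : Prop :=
  forall x y, g x = g y -> [\/ x = y, x = u /\ y = v | x = v /\ y = u].

Lemma compat_max_red_deg (G K : trigraph) (g : G -> K) :
  compat g -> injective g -> max_red_deg G <= max_red_deg K.
Proof.
move=> [ga gb] gI; apply: max_red_deg_leP => x.
apply: leq_trans (leq_bigmax (g x)).
rewrite /red_deg -(card_imset _ gI); apply/subset_leq_card/subsetP => z.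
case/imsetP=> y; rewrite !inE => xy ->{z}.
have [|/gI xyE|] := ga x y; first by rewrite /adj xy orbT.
  by move: xy; rewrite xyE red_irr.
case/orP=> // /gb; move: (black_red x y); rewrite xy andbT => /negP //.
Qed.

(** If [g] identifies distinct [u] and [v], contracting them leaves an injective compatible map to
    [K]; otherwise [g] itself is injective. Monotonicity below [K] is a premise, so that the lemma
    can serve inside the induction proving monotonicity. *)
Lemma tww_atmost_fold_aux (G K : trigraph) (g : G -> K) (u v : G) k :
    (forall (L : trigraph) (f : L -> K), compat f -> injective f -> 0 < #|L| ->
       tww_atmost k L) ->
    compat g -> collapses_only g u v -> 0 < #|G| -> max_red_deg G <= k ->
  tww_atmost k G.
Proof.
move=> Kk gc guv G_gt0 Gk.
have [uvE|uv] := eqVneq u v.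
  apply: Kk gc _ G_gt0 => x y /guv[|[-> ->]|[-> ->]] //.
have [guvE|guvN] := eqVneq (g u) (g v); last first.
  apply: Kk gc _ G_gt0 => x y gxy; have [|[xu yv]|[xv yu]] // := guv _ _ gxy.
    by case/eqP: guvN; rewrite -xu -yv.
  by case/eqP: guvN; rewrite -xv -yu.
have [||s sk] := Kk _ _ (compat_contract_lift gc guvE).
- case=> [x|] [y|] //= /guv.
  + case=> [/val_inj -> //|[xu]|[xv]].
      by have := valP x; rewrite /= xu eqxx.
    by have := valP x; rewrite /= xv eqxx andbF.
  + case=> [xu|[xu]|[xv]].
    * by have := valP x; rewrite /= xu eqxx.
    * by have := valP x; rewrite /= xu eqxx.
    * by have := valP x; rewrite /= xv eqxx andbF.
  + case=> [xu|[_ xu]|[_ xv]].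
    * by have := valP y; rewrite /= -xu eqxx.
    * by have := valP y; rewrite /= xu eqxx andbF.
    * by have := valP y; rewrite /= xv eqxx.
- by apply/card_gt0P; exists None.
by exists (ContractionStep uv s); rewrite /= geq_max Gk.
Qed.

(** The contraction sequence of [K] is imitated: a step merging [u] and [v] is performed in [G] if
    both have preimages, and skipped otherwise, since the composite map is then still injective.
    Compatibility bounds the red degrees at every stage. *)
Lemma tww_atmost_compat_inj k (K : trigraph) :
  tww_atmost k K -> forall (G : trigraph) (g : G -> K), compat g -> injective g
    ->
  0 < #|G| -> tww_atmost k G.
Proof.
case=> s; elim: s => {K} [K K1|K u v uv s IHs] sk G g gc gI G_gt0.
  have G1 : #|G| = 1.
    by apply/eqP; rewrite eqn_leq G_gt0 andbT -K1; exact: leq_card gI.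
  exists (ContractionEnd G1) => /=.
  exact: leq_trans (compat_max_red_deg gc gI) sk.
move: sk; rewrite /= geq_max => /andP[Kk sk].
pose f := contract_proj u v \o g.
have fc : compat f by apply: compat_comp gc _; exact: compat_contract_proj.
have Gk := leq_trans (compat_max_red_deg gc gI) Kk.
(* When [u] or [v] has no preimage, the degenerate pair [x x] is passed to the folding lemma, as [f]
   is then injective. *)
have [x /eqP gx|xN] := pickP (fun x => g x == u); last first.
  have /card_gt0P[x _] := G_gt0.
  apply: (@tww_atmost_fold_aux _ _ f x x k (IHs sk) fc) => //.
  move=> y z; rewrite /f /=.
  case: (contract_projP u v (g y)) => [[yuv ->]|[a ay ->]];
    case: (contract_projP u v (g z)) => [[zuv ->]|[b bz ->]] //.
    case: yuv => [/eqP|yv]; first by rewrite xN.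
    case: zuv => [/eqP|zv]; first by rewrite xN.
    by move=> _; constructor 1; apply: gI; rewrite yv zv.
  by case=> ab; constructor 1; apply: gI; rewrite -ay -bz ab.
have [y /eqP gy|yN] := pickP (fun x => g x == v).
  apply: (@tww_atmost_fold_aux _ _ f x y k (IHs sk) fc) => //.
  move=> y' z; rewrite /f /=.
  case: (contract_projP u v (g y')) => [[yuv ->]|[a ay ->]];
    case: (contract_projP u v (g z)) => [[zuv ->]|[b bz ->]] //.
    move=> _; case: yuv zuv => e [] e'.
    - by constructor 1; apply: gI; rewrite e.
    - by constructor 2; split; apply: gI; rewrite ?e ?e' ?gx ?gy.
    - by constructor 3; split; apply: gI; rewrite ?e ?e' ?gx ?gy.
    - by constructor 1; apply: gI; rewrite e.
  by case=> ab; constructor 1; apply: gI; rewrite -ay -bz ab.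
apply: (@tww_atmost_fold_aux _ _ f x x k (IHs sk) fc) => //.
move=> y z; rewrite /f /=.
case: (contract_projP u v (g y)) => [[yuv ->]|[a ay ->]];
  case: (contract_projP u v (g z)) => [[zuv ->]|[b bz ->]] //.
  case: yuv => [yv|/eqP]; last by rewrite yN.
  case: zuv => [zv|/eqP]; last by rewrite yN.
  by move=> _; constructor 1; apply: gI; rewrite yv zv.
by case=> ab; constructor 1; apply: gI; rewrite -ay -bz ab.
Qed.

(** The tool for building contraction sequences backwards: contract [u] and [v], then follow the
    sequence of [K]. *)
Lemma tww_atmost_fold k (G K : trigraph) (g : G -> K) (u v : G) :
  compat g -> collapses_only g u v -> 0 < #|G| -> max_red_deg G <= k ->
  tww_atmost k K -> tww_atmost k G.
Proof.
by move=> gc guv G_gt0 Gk Kk; apply: tww_atmost_fold_aux gc guv G_gt0 Gk => L f;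
  exact: tww_atmost_compat_inj.
Qed.

(** * Cardinality estimates *)

Lemma card_sum_set (A B : finType) (P : pred (A + B)) :
  #|[set v | P v]| = #|[set a | P (inl a)]| + #|[set b | P (inr b)]|.
Proof. by rewrite -!sum1dep_card big_sumType. Qed.

Lemma card_le1_set (T : finType) (P : pred T) :
  (forall x y, P x -> P y -> x = y) -> #|[set x | P x]| <= 1.
Proof. by move=> PI; apply/card_le1_eqP => x y; rewrite !inE => Px Py;
  exact: PI. Qed.

Lemma card_set_leU (T : finType) (P Q R : pred T) :
  (forall x, P x -> Q x || R x) ->
  #|[set x | P x]| <= #|[set x | Q x]| + #|[set x | R x]|.
Proof.
move=> PQR; apply: leq_trans (leq_card_setU _ _).
by apply/subset_leq_card/subsetP => x; rewrite !inE => /PQR.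
Qed.

Lemma card_ord_adjacent n (p : 'I_n) (P : pred 'I_n) :
  (forall q : 'I_n, P q -> (p.+1 == q) || (q.+1 == p)) -> #|[set q | P q]| <= 2.
Proof.
move=> Pp; apply: leq_trans (card_set_leU Pp) _.
rewrite -(addn1 1) leq_add // card_le1_set // => x y /eqP xE /eqP yE.
  by apply: val_inj; rewrite /= -xE -yE.
by apply: val_inj; apply: succn_inj; rewrite /= xE yE.
Qed.

(** * Trigraphs with a red appendage *)

Section Tailed.
Variables (C : trigraph) (B : finType) (e : rel B) (att : C -> B -> bool).

Definition tailed_black (a b : C + B) : bool :=
  if a is inl x then if b is inl y then black x y else false else false.

(** Here [e] is symmetrised and stripped of loops, so that an edge of [B] may be given in one
    direction. *)
Definition tailed_red (a b : C + B) : bool :=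
  match a, b with
  | inl x, inl y => red x y
  | inl x, inr p | inr p, inl x => att x p
  | inr p, inr q => (p != q) && (e p q || e q p)
  end.

Lemma tailed_black_sym : symmetric tailed_black.
Proof. by case=> [x|p] [y|q] //=; rewrite black_sym. Qed.

Lemma tailed_black_irr : irreflexive tailed_black.
Proof. by case=> [x|p] //=; rewrite black_irr. Qed.

Lemma tailed_red_sym : symmetric tailed_red.
Proof. by case=> [x|p] [y|q] //=; rewrite 1?red_sym // eq_sym orbC. Qed.

Lemma tailed_red_irr : irreflexive tailed_red.
Proof. by case=> [x|p] //=; rewrite ?red_irr // eqxx. Qed.

Lemma tailed_black_red a b : ~~ (tailed_black a b && tailed_red a b).
Proof. by case: a b => [x|p] [y|q] //=; exact: black_red. Qed.

Definition tailed : trigraph :=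
  Trigraph tailed_black_sym tailed_black_irr tailed_red_sym tailed_red_irr
    tailed_black_red.

Lemma red_deg_tailedl (x : C) :
  @red_deg tailed (inl x) = red_deg x + #|[set p | att x p]|.
Proof. by rewrite /red_deg card_sum_set. Qed.

Lemma red_deg_tailedr (p : B) :
  @red_deg tailed (inr p) =
  #|[set x | att x p]| + #|[set q | (p != q) && (e p q || e q p)]|.
Proof. by rewrite /red_deg card_sum_set. Qed.

Lemma compat_to_tailed (G : trigraph) (f : G -> C + B) :
  (forall x y, adj x y ->
     match f x, f y with
     | inl a, inl b => a = b \/ adj a b
     | inl a, inr p | inr p, inl a => att a p
     | inr p, inr q => [\/ p = q, e p q | e q p]
     end) ->
  (forall x y a b, f x = inl a -> f y = inl b -> black a b -> black x y) ->
  @compat G tailed f.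
Proof.
move=> fa fb; split=> x y.
  move=> /fa; rewrite {2}/adj /=; case: (f x) (f y) => [a|p] [b|q] /=.
  - by case=> [->|]; [left|right].
  - by right.
  - by right.
  - have [->|pq /=] := eqVneq p q; first by left.
    by case=> [pqE|->|->]; rewrite ?orbT; [move: pq;
      rewrite pqE eqxx|right|right].
case fx: (f x) => [a|p]; case fy: (f y) => [b|q] //=.
exact: fb fx fy.
Qed.

End Tailed.

(** * The bus *)

Definition bus (C : trigraph) (n : nat) (r : C -> nat) : trigraph :=
  tailed (fun p q : 'I_n.+1 => p.+1 == q) (fun x p => r x == p).

(** A vertex of [C] gains at most one bus vertex. A bus vertex has at most two neighbours on the bus
    and two attached vertices, and [4 <= t.+1] because [3 <= t]. *)
Lemma max_red_deg_bus t (C : trigraph) n (r : C -> nat) :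
  3 <= t -> (forall x : C, red_deg x <= t) ->
  (forall k, #|[set x | r x == k]| <= 2) -> max_red_deg (bus n r) <= t.+1.
Proof.
move=> t3 Ct r2; apply: max_red_deg_leP; case=> [x|p].
  rewrite red_deg_tailedl -(addn1 t) leq_add // card_le1_set // => p q /eqP xp
    /eqP xq.
  by apply: val_inj; rewrite /= -xp -xq.
rewrite red_deg_tailedr; apply: leq_trans (_ : 4 <= _); last by [].
rewrite -[4]/(2 + 2) leq_add // (card_ord_adjacent (p := p)) // => q /andP[] //.
Qed.

Lemma tww_atmost_gt0 k (G : trigraph) : tww_atmost k G -> 0 < #|G|.
Proof. by case=> s _; case: s => [K -> //|K u v _ _]; apply/card_gt0P;
  exists u. Qed.

(* The bus lists the vertices of [C] in the order of the leaves of the binary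
   tree of contractions, so that every contraction merges two vertices attached
   to consecutive vertices of the bus. *)
Lemma bus_order t (C : trigraph) (s : contraction_seq C) :
  3 <= t -> width s <= t ->
  exists r : C -> nat, [/\ injective r, forall x, r x < #|C|
    & tww_atmost t.+1 (bus #|C|.-1 r)].
Proof.
move=> t3; elim: s => {C} [C C1|C u v uv s IHs] st.
  have Ct (x : C) : red_deg x <= t by exact: leq_trans (leq_bigmax x) st.
  have allC (x y : C) : x = y by apply: (fintype_le1P _); rewrite C1.
  have /card_gt0P[x0 _] : 0 < #|C| by rewrite C1.
  exists (fun=> 0); split=> [x y _|x|]; first exact: allC; first by rewrite C1.
  (* The bus has a single vertex; contracting it with the only vertex of [C] ends the sequence. *)
  pose g (a : bus #|C|.-1 (fun=> 0)) : C := if a is inl x then x else x0.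
  apply: (@tww_atmost_fold _ _ C g (inl x0) (inr ord0)).
  - by split=> x y; [left; exact: allC|rewrite (allC (g x) (g y)) black_irr].
  - have ordE (p : 'I_#|C|.-1.+1) : p = ord0.
      by apply: val_inj; case: p => m /=; rewrite C1 /= ltnS leqn0 => /eqP.
    case=> [x|p] [y|q] _.
    + by constructor 1; rewrite (allC x y).
    + by constructor 2; rewrite (allC x x0) (ordE q).
    + by constructor 3; rewrite (allC y x0) (ordE p).
    + by constructor 1; rewrite (ordE p) (ordE q).
  - by apply/card_gt0P; exists (inl x0).
  - apply: max_red_deg_bus => // k; apply: leq_trans (max_card _) _.
    by rewrite C1.
  - by exists (ContractionEnd C1); exact: leq_trans st _.
move: st; rewrite /= geq_max => /andP[Ct /IHs[r1 [r1I r1C busC]]].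
have {}Ct (x : C) : red_deg x <= t by exact: leq_trans (leq_bigmax x) Ct.
have cC : #|contract u v| = #|C|.-1 := card_contract uv.
have C_gt1 : 1 < #|C|.
  by have := tww_atmost_gt0 busC; have := r1C None; rewrite cC; lia.
have [n nE] : exists n, #|C| = n.+2 by exists #|C|.-2; lia.
move: r1C busC; rewrite cC nE /= => r1C busC.
pose pr := contract_proj u v.
have pr_u : pr u = None by case: (contract_projP u v u) => [[]//|[z]];
  have := valP z => /= + zu; rewrite zu eqxx.
have pr_v : pr v = None by case: (contract_projP u v v) => [[]//|[z]];
  have := valP z => /= + zu; rewrite zu eqxx andbF.
have prI x y : pr x = pr y -> [\/ x = y, x = u /\ y = v | x = v /\ y = u].
  rewrite /pr; case: (contract_projP u v x) => [[xuv ->]|[a <- ->]];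
    case: (contract_projP u v y) => [[yuv ->]|[b <- ->]] //; last first.
    by case=> ->; constructor 1.
  move=> _; case: xuv yuv => -> [] ->;
    by [constructor 1|constructor 2|constructor 3].
(* The leaf [None] at position [k] splits in two: [u] keeps [k], [v] takes [k.+1], and all later
   positions move up by one. *)
pose k := r1 None.
pose r x := if x == v then k.+1 else
  if k < r1 (pr x) then (r1 (pr x)).+1 else r1 (pr x).
have rr1 x : r1 (pr x) = if k < r x then (r x).-1 else r x.
  rewrite /r; have [->|_] := eqVneq x v; first by rewrite pr_v -/k ltnSn.
  by case: (ltnP k (r1 _)) => H; case: ltnP => //=; lia.
have rI : injective r.
  move=> x y xyE; have /r1I/prI : r1 (pr x) = r1 (pr y) by rewrite !rr1 xyE.
  case=> // -[xE yE]; move: xyE;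
    rewrite xE yE /r eqxx (negPf uv) pr_u -/k ltnn; lia.
have rC x : r x < n.+2.
  rewrite /r; have := r1C (pr x); have := r1C None; rewrite -/k.
  by case: eqP => _; [lia|case: ifP => _; lia].
exists r; split=> //.
(* In this intermediate trigraph the bus is already shortened while [C] is not yet contracted: [u]
   and [v] both hang on the bus vertex [k]. Contracting them leads to [bus n r1]. *)
pose merged := bus n (r1 \o pr).
have merged_tww : tww_atmost t.+1 merged.
  pose g (a : merged) : bus n r1 :=
    match a with inl x => inl (pr x) | inr p => inr p end.
  apply: (@tww_atmost_fold _ _ (bus n r1) g (inl u) (inl v)) => //.
  - have [ca cb] := compat_contract_proj u v.
    apply: compat_to_tailed => [[x|p] [y|q]|[x|p] [y|q]] //=.
    + exact: ca.
    + by case/orP=> // /andP[_] /orP[] ?; [constructor 2|constructor 3].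
    + by move=> a b [<-] [<-] /cb.
  - case=> [x|p] [y|q] //= [].
    + by case/prI => [->|[-> ->]|[-> ->]];
        [constructor 1|constructor 2|constructor 3].
    + by move=> ->; constructor 1.
  - by apply/card_gt0P; exists (inl u).
  (* Away from [v] the map [pr] is injective, so a bus vertex carries at most one vertex besides
     [v]. *)
  - apply: max_red_deg_bus => // l.
    rewrite -(addn1 1); pose Q x := (x != v) && (r1 (pr x) == l).
    apply: leq_trans (card_set_leU (Q := Q) (R := pred1 v) _) _.
      by move=> x /= xl; rewrite /Q xl; case: eqVneq.
    rewrite leq_add // card_le1_set // => x y; last by move=> /eqP -> /eqP ->.
    move=> /andP[xv /eqP xl] /andP[yv /eqP yl].
    have /r1I/prI : r1 (pr x) = r1 (pr y) by rewrite xl yl.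
    by case=> // -[xE yE]; [move: yv; rewrite yE eqxx|move: xv;
      rewrite xE eqxx].
(* The first contraction of the sequence merges the bus vertices [k] and [k.+1]; later ones move
   down by one. *)
pose g (a : bus n.+1 r) : merged :=
  match a with inl x => inl x | inr p => inr (inord (if k < p then p.-1 else
    p)) end.
have k_le : k < n.+1 := r1C None.
have gE (p : 'I_n.+2) : (inord (if k < p then p.-1 else p) : 'I_n.+1) = (if k <
  p then p.-1 else p) :> nat.
  by rewrite inordK //; have := ltn_ord p; case: (ltnP k p); lia.
have k1 : k.+1 < n.+2 by [].
apply: (@tww_atmost_fold _ _ merged g (inr (Ordinal (ltnW k1))) (inr (Ordinal
  k1))) => //.
- apply: compat_to_tailed => [[x|p] [y|q]|[x|p] [y|q]] //=.
  + by right.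
  + by rewrite /adj /= gE rr1 => /eqP ->.
  + by rewrite /adj /= gE rr1 => /eqP ->.
  + rewrite /adj /= !gE => /andP[_] pq.
    have [//|H] : (if k < p then p.-1 else p) = (if k < q then q.-1 else q) \/
      ((if k < p then p.-1 else p).+1 == (if k < q then q.-1 else q) \/ (if k <
        q then q.-1 else q).+1 == (if k < p then p.-1 else p)).
    * by move: pq; case: (ltnP k p); case: (ltnP k q); lia.
    * by move=> ->; constructor 1.
    * by case: H => ->; [constructor 2|constructor 3].
  + by move=> a b [->] [->].
- case=> [x|p] [y|q] //= [].
    by move=> ->; constructor 1.
  move=> /(congr1 val) /=; rewrite !gE => pq.
  have [pqE|pqN] := eqVneq p q; first by rewrite pqE; constructor 1.
  have {}pqN : p <> q :> nat by move=> /val_inj/eqP; rewrite (negPf pqN).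
  have [[pk qk]|[pk qk]] : (p = k :> nat /\ q = k.+1 :> nat) \/ (q = k :> nat
    /\ p = k.+1 :> nat).
  + by move: pq; case: (ltnP k p); case: (ltnP k q); lia.
  + by constructor 2; split; congr inr; apply: val_inj.
  + by constructor 3; split; congr inr; apply: val_inj.
- by apply/card_gt0P; exists (inl u).
- apply: max_red_deg_bus => // l; apply: leq_trans (_ : 1 <= _) => //.
  by apply: card_le1_set => x y /eqP xl /eqP yl; apply: rI; rewrite xl yl.
Qed.

(** * Zipping a path into the bus *)

Definition close (p q : nat) : bool := (p <= q.+1) && (q <= p.+1).

Section Rail.
Variables (C : trigraph) (n : nat) (r : C -> nat).

(* A letter [(h, c)] stands for a vertex to be merged with the vertex [h] of the
   bus, and attached to [c] if [c] is a vertex of [C]. *)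
Notation letter := (nat * option C)%type.
Notation nil_letter := ((0, None) : letter).

Definition rail_edge (p : nat) (w : seq letter) (a b : 'I_n.+1 + 'I_(size w)) :=
  match a, b with
  | inl q, inl q' => q.+1 == q'
  | inl q, inr j =>
      [&& q == p :> nat, j == 0 :> nat & close p (nth nil_letter w j).1]
  | inr j, inr j' => (j.+1 == j') &&
      close (nth nil_letter w j).1 (nth nil_letter w j').1
  | inr _, inl _ => false
  end.

Definition rail_att (w : seq letter) (x : C) (a : 'I_n.+1 + 'I_(size w)) :=
  match a with
  | inl q => r x == q
  | inr j => (nth nil_letter w j).2 == Some x
  end.

(* The bus together with a path whose vertices are the letters of [w] and whose
   first vertex hangs on the vertex [p] of the bus; edges of the path between
   letters that are not close are left out. *)
Definition rail (p : nat) (w : seq letter) : trigraph :=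
  tailed (@rail_edge p w) (@rail_att w).

(** A letter attached to a vertex of [C] sits where that vertex already hangs, so merging the letter
    with the bus creates no new attachment. *)
Definition letter_ok (l : letter) : bool :=
  (l.1 <= n) && (if l.2 is Some x then r x == l.1 else true).

(** A bus vertex has at most one neighbour in [C], two on the bus and one letter; a letter has at
    most one neighbour in [C], one on the bus and two letters. Both totals are 4. *)
Lemma max_red_deg_rail t p (w : seq letter) :
  3 <= t -> injective r ->
  (forall x, red_deg x + count (fun l : letter => l.2 == Some x) w <= t) ->
  max_red_deg (rail p w) <= t.+1.
Proof.
move=> t3 rI wt; apply: max_red_deg_leP; case=> [x|a].
  rewrite red_deg_tailedl card_sum_set /= addnCA -(add1n t) leq_add //.
    apply: card_le1_set => q q' /eqP xq /eqP xq'.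
    by apply: val_inj; rewrite /= -xq -xq'.
  apply: leq_trans (wt x); rewrite leq_add2l -sum1_count (big_nth nil_letter).
  by rewrite big_mkord sum1dep_card.
rewrite red_deg_tailedr; apply: leq_trans (_ : 4 <= _); last by [].
rewrite -[4]/(1 + 3) leq_add //.
  apply: card_le1_set; case: a => [q|j] x y /= /eqP xa /eqP ya.
    by apply: rI; rewrite xa ya.
  by move: xa; rewrite ya => -[].
rewrite card_sum_set; case: a => [q|j] /=.
  rewrite -[3]/(2 + 1) leq_add //.
    by apply: (card_ord_adjacent (p := q)) => q' /andP[].
  apply: card_le1_set => j j';
    rewrite !orbF => /and3P[_ /eqP j0 _] /and3P[_ /eqP j'0 _].
  by apply: val_inj; rewrite /= j0 j'0.
rewrite -[3]/(1 + 2) leq_add //.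
  apply: card_le1_set => q q' /and3P[/eqP qp _ _] /and3P[/eqP q'p _ _].
  by apply: val_inj; rewrite /= qp q'p.
apply: (card_ord_adjacent (p := j)) => j' /andP[_] /orP[] /andP[-> _] //.
by rewrite orbT.
Qed.

(** Once the first letter is contracted into its bus vertex [h], the remaining path hangs on [h]. An
    edge from [p] to that letter becomes a loop or a bus edge, since [close] makes [p] and [h] equal
    or consecutive. *)
Lemma tww_atmost_rail t p (w : seq letter) :
  3 <= t -> injective r -> 0 < #|C| -> all letter_ok w ->
  (forall x, red_deg x + count (fun l : letter => l.2 == Some x) w <= t) ->
  tww_atmost t.+1 (bus n r) -> tww_atmost t.+1 (rail p w).
Proof.
move=> t3 rI /card_gt0P[x0 _] + + busC; elim: w p => [|[h c] w IHw] p /=.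
  move=> _ _; pose g (a : rail p [::]) : bus n r :=
    match a with
    | inl x => inl x | inr (inl q) => inr q | inr (inr _) => inr ord0
    end.
  apply: (tww_atmost_compat_inj busC (g := g)).
  - apply: compat_to_tailed => [[x|[q|[]//]] [y|[q'|[]//]]|[x|[q|[]//]]
      [y|[q'|[]//]]] //=.
    + by right.
    + by rewrite /adj /= => /andP[_] /orP[] ?; [constructor 2|constructor 3].
    + by move=> a b [->] [->].
  - by move=> [x|[q|[]//]] [y|[q'|[]//]] //= [] ->.
  - by apply/card_gt0P; exists (inl x0).
move=> /andP[/andP[/= hn hc] w_ok] wt.
have hE : (inord h : 'I_n.+1) = h :> nat by rewrite inordK.
pose g (a : rail p ((h, c) :: w)) : rail h w :=
  match a with
  | inl x => inl x
  | inr (inl q) => inr (inl q)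
  | inr (inr j) =>
      if unlift ord0 j is Some j' then inr (inr j') else inr (inl (inord h))
  end.
apply: (@tww_atmost_fold _ _ (rail h w) g (inr (inl (inord h))) (inr (inr
  ord0))).
- apply: compat_to_tailed => [[x|[q|j]] [y|[q'|j']]|[x|[q|j]] [y|[q'|j']]] //=;
    rewrite /adj /=; try (by case: (unliftP ord0 _)).
  + by right.
  + case: (unliftP ord0 j') => [i ->|->] //= /eqP cx.
    by move: hc; rewrite cx hE.
  + by case/andP=> _ /orP[] ?; [constructor 2|constructor 3].
  + rewrite orbF => /and3P[/eqP qp]; case: (unliftP ord0 j') => [i ->|->] //= _.
    rewrite /close => ph; have [qh|qh] := eqVneq (q : nat) h.
      by constructor 1; congr inl; apply: val_inj; rewrite /= hE.
    have [?|?] : q.+1 == h \/ h.+1 == q by move: qh ph; rewrite -qp; lia.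
      by constructor 2; rewrite hE.
    by constructor 3; rewrite hE.
  + case: (unliftP ord0 j) => [i ->|->] //= /eqP xc.
    by move: hc; rewrite xc hE.
  + rewrite /= => /and3P[/eqP qp]; case: (unliftP ord0 j) => [i ->|->] //= _.
    rewrite /close => ph; have [qh|qh] := eqVneq (q' : nat) h.
      by constructor 1; congr inl; apply: val_inj; rewrite /= hE.
    have [?|?] : q'.+1 == h \/ h.+1 == q' by move: qh ph; rewrite -qp; lia.
      by constructor 3; rewrite hE.
    by constructor 2; rewrite hE.
  + case: (unliftP ord0 j) => [i ->|->];
      case: (unliftP ord0 j') => [i' ->|->] //=.
    * by case/andP=> _ /orP[] ?; [constructor 2|constructor 3].
    * by case/andP=> /eqP[i0] hi; constructor 3; rewrite hE eqxx; move: i0 hi;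
        rewrite add0n => <- ->.
    * rewrite orbF; case/andP=> /eqP[i0] hi.
      by constructor 2; rewrite hE eqxx; move: i0 hi; rewrite add0n => <- ->.
  + by move=> a b [->] [->].
- move=> [x|[q|j]] [y|[q'|j']] //=; try (by case: (unliftP ord0 _)).
  + by case=> ->; constructor 1.
  + by case=> ->; constructor 1.
  + by case: (unliftP ord0 j') => [i ->|->] //= [->]; constructor 2.
  + by case: (unliftP ord0 j) => [i ->|->] //= [->]; constructor 3.
  + case: (unliftP ord0 j) => [i ->|->];
      case: (unliftP ord0 j') => [i' ->|->] //=.
      by case=> ->; constructor 1.
    by constructor 1.
- by apply/card_gt0P; exists (inl x0).
- exact: max_red_deg_rail.
- apply: IHw => // x; apply: leq_trans (wt x).
  by rewrite leq_add2l leq_addl.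
Qed.

End Rail.

(** * Ears, their shortening, and the resulting bound *)

Section Ears.
Variables (C : trigraph) (I : finType) (a b : I -> C).

(* Adjacency in the trigraph formed by [C] and, for each [i], a path of [n i]
   vertices [(i, 0)], [(i, 1)], ..., joining [a i] to [b i]. *)
Definition ear_edge (n : I -> nat) (p q : C + I * nat) : bool :=
  match p, q with
  | inl x, inl y => adj x y
  | inl x, inr (i, j) | inr (i, j), inl x =>
      ((j == 0) && (a i == x)) || ((j.+1 == n i) && (b i == x))
  | inr (i, j), inr (i', j') => (i == i') && ((j.+1 == j') || (j'.+1 == j))
  end.

Lemma ear_edge_sym n : symmetric (ear_edge n).
Proof.
by case=> [x|[i j]] [y|[i' j']] //=; rewrite 1?adj_sym // eq_sym orbC.
Qed.

Definition in_ear (G : trigraph) (pos : G -> C + I * nat) (i : I) (X : {set G})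
  :=
  forall x, x \in X -> exists j, pos x = inr (i, j).

(** This is the invariant of shortening: up to reddening, [G] is contained in [C] with its ears.
    Each path lies in one ear, so a contraction affects a single ear; each ear contains a path, so
    long paths force long ears. *)
Definition ear_layout (G : trigraph) (P : {set {set G}}) (n : I -> nat)
    (pos : G -> C + I * nat) : Prop :=
  [/\ injective pos,
      forall x i j, pos x = inr (i, j) -> j < n i,
      forall x y, adj x y -> ear_edge n (pos x) (pos y),
      forall x y c d, pos x = inl c -> pos y = inl d -> black c d -> black x y
    & (forall X, X \in P -> exists i, in_ear pos i X) /\
      (forall i, exists2 X, X \in P & in_ear pos i X)].

(** Adjacent vertices of a path sit at consecutive positions [k] and [k.+1] of one ear. Contracting
    them shortens that ear by one, and the later positions move down to close the gap. *)
Lemma ear_layout_contract (G : trigraph) (P : {set {set G}}) n pos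
    (X : {set G}) (u v : G) :
  ear_layout P n pos -> X \in P -> u \in X -> v \in X -> adj u v ->
  exists n' pos',
    ear_layout [set contract_proj u v @: (Y : {set G}) | Y in P] n' pos'.
Proof.
case=> posI posn posE posB [Pear earP] XP uX vX uv.
have [i Xi] := Pear X XP.
have [ju pu] := Xi u uX; have [jv pv] := Xi v vX.
pose k := minn ju jv.
have uvk : (ju == k) && (jv == k.+1) || (ju == k.+1) && (jv == k).
  by have := posE _ _ uv; rewrite pu pv /= eqxx /= /k; lia.
have k_lt : k.+1 < n i by have := posn _ _ _ pu; have := posn _ _ _ pv; lia.
pose sh (p : C + I * nat) : C + I * nat :=
  if p is inr (i', j) then inr (i', if (i' == i) && (k < j) then j.-1 else j)
  else p.
pose n' i' := if i' == i then (n i').-1 else n i'.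
have shu : sh (pos u) = inr (i, k).
  by rewrite pu /= eqxx /=; congr (inr (_, _)); case: (ltnP k ju); lia.
have shv : sh (pos v) = inr (i, k).
  by rewrite pv /= eqxx /=; congr (inr (_, _)); case: (ltnP k jv); lia.
have shI x y : sh (pos x) = sh (pos y) -> [\/ x = y, x = u /\ y = v | x = v /\
  y = u].
  case px: (pos x) => [c|[i1 j1]]; case py: (pos y) => [d|[i2 j2]] //=.
    by case=> cd; constructor 1; apply: posI; rewrite px py cd.
  case=> i12; rewrite -i12 in py *; have [i1E|i1N] /= := eqVneq i1 i;
    last first.
    by move=> j12; constructor 1; apply: posI; rewrite px py j12.
  rewrite i1E in px py * => j12; have [jE|jN] := eqVneq j1 j2.
    by constructor 1; apply: posI; rewrite px py jE.
  have posP z j : pos z = inr (i, j) -> (j == ju -> z = u) /\ (j == jv -> z =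
    v).
    by move=> pz; split=> /eqP jE; apply: posI; rewrite pz jE.
  have [xu xv] := posP x j1 px; have [yu yv] := posP y j2 py.
  have : (j1 == ju) && (j2 == jv) || (j1 == jv) && (j2 == ju).
    by move: j12 jN uvk; case: (ltnP k j1); case: (ltnP k j2); lia.
  by case/orP=> /andP[]; [move=> /xu ? /yv ?; constructor 2
                         |move=> /xv ? /yu ?; constructor 3].
have shE x y : ear_edge n (pos x) (pos y) ->
    sh (pos x) <> sh (pos y) -> ear_edge n' (sh (pos x)) (sh (pos y)).
  (* Ends stay ends: position 0 never exceeds [k], whereas the last position does, by [k.+1 < n i],
     and so moves down together with the length. *)
  have inlr c i1 j1 : ear_edge n (inl c) (inr (i1, j1)) ->
      ear_edge n' (inl c) (sh (inr (i1, j1))).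
    rewrite /= /n'; have [->|//] := eqVneq i1 i => /=.
    case/orP=> /andP[/eqP jE ->]; rewrite !andbT; apply/orP; [left|right].
      by rewrite jE.
    by case: (ltnP k j1); lia.
  case: (pos x) (pos y) => [c|[i1 j1]] [d|[i2 j2]] //.
  - by move=> + _; exact: inlr.
  - by rewrite ear_edge_sym => + _; rewrite ear_edge_sym; exact: inlr.
  - rewrite /= => /andP[/eqP <-] j12; rewrite eqxx /=; case: (i1 == i) => //=.
    move=> jN; have {}jN : (if k < j1 then j1.-1 else j1) <> (if k < j2 then
      j2.-1 else j2).
      by move=> jE; apply: jN; rewrite jE.
    by move: j12 jN; case: (ltnP k j1); case: (ltnP k j2); lia.
have uvN : u != v by apply/eqP => uvE; rewrite uvE adj_irr in uv.
pose pos' (z : contract u v) := if z is Some x then sh (pos (val x)) else inr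
  (i, k).
have posp x : pos' (contract_proj u v x) = sh (pos x).
  by case: (contract_projP u v x) => [[[->|->] ->]|[z <- ->]] /=.
have valN (z : {x : G | (x != u) && (x != v)}) : val z <> u /\ val z <> v.
  by have /andP[zu zv] := valP z; split; apply/eqP.
have pos'I : injective pos'.
  case=> [x|] [y|] //=.
  - case/shI=> [/val_inj -> //|[xu _]|[xv _]]; by have [] := valN x.
  - rewrite -shu => /shI; have [xu xv] := valN x.
    by case=> [//|[//]|[//]].
  - rewrite -shu => /shI; have [yu yv] := valN y.
    by case=> [|[_]|[_]] // /esym.
exists n', pos'; split=> //.
- have shn p i1 j1 : (forall i j, p = inr (i, j) -> j < n i) ->
      sh p = inr (i1, j1) -> j1 < n' i1.
    case: p => // -[i2 j2] /(_ _ _ erefl) + [<- <-]; rewrite /n' => j2n.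
    have [i1E|//] := eqVneq i2 i; rewrite /= i1E in j2n *.
    by case: (ltnP k j2); lia.
  case=> [x|] i1 j1 /=; first by apply: shn => i2 j2; exact: posn.
  by case=> <- <-; rewrite /n' eqxx; lia.
- have E1 z w : adj (val z) w -> (w = u \/ w = v) -> ear_edge n' (pos' (Some
    z)) (pos' None).
    move=> zw wuv; have -> : pos' None = sh (pos w) by case: wuv => ->.
    apply: shE; first exact: posE.
    case/shI=> [wE|[zE _]|[zE _]]; have [zu zv] := valN z => //.
    by case: wuv => wE'; rewrite wE' in wE.
  case=> [x|] [y|] xy.
  + apply: shE; first exact: posE.
    move=> /(@pos'I (Some x) (Some y)) [] xyE.
    by move: xy; rewrite xyE adj_irr.
  + move: xy; rewrite adj_sym adj_contract_None.
    by case/orP; rewrite adj_sym => /E1; apply; [left|right].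
  + move: xy; rewrite adj_contract_None ear_edge_sym.
    by case/orP; rewrite adj_sym => /E1; apply; [left|right].
  + by rewrite adj_irr in xy.
- case=> [x|] [y|] c d //=.
  have shl p e : sh p = inl e -> p = inl e by case: p => [|[]].
  by move=> /shl pc /shl pd; exact: posB.
- have imE i1 Y : in_ear pos i1 Y -> in_ear pos' i1 (contract_proj u v @: Y).
    move=> Yi1 z /imsetP[y yY ->]; have [j pj] := Yi1 y yY.
    by rewrite posp pj /=; eexists.
  split=> [Z /imsetP[Y YP ->]|i1].
    by have [i1 Yi1] := Pear Y YP; exists i1; exact: imE.
  by have [Y YP Yi1] := earP i1; exists (contract_proj u v @: Y);
    [exact: imset_f|exact: imE].
Qed.

Lemma ear_layout_shortening (G G' : trigraph) (P : {set {set G}})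
    (P' : {set {set G'}}) n pos :
  shortening P' P -> 0 < #|G| -> ear_layout P n pos ->
  0 < #|G'| /\ exists n' pos', ear_layout P' n' pos'.
Proof.
move=> PP'; elim: PP' n pos => {G P} [|G P X u v XP uX vX uv _ IH] n pos G_gt0
  Ppos.
  by split=> //; exists n, pos.
have [n1 [pos1 lay]] := ear_layout_contract Ppos XP uX vX uv.
by apply: IH lay; apply/card_gt0P; exists None.
Qed.

(** The vertices of a path inside the ear have distinct positions below [n i]. *)
Lemma ear_layout_card (G : trigraph) (P : {set {set G}}) n pos i :
  ear_layout P n pos -> exists2 X, X \in P & #|X| <= n i.
Proof.
case=> posI posn _ _ [_ /(_ i)[X XP Xi]]; exists X => //.
pose rk x := if pos x is inr (_, j) then j else 0.
rewrite cardE -(size_map rk) -(size_iota 0 (n i)); apply: uniq_leq_size.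
  rewrite map_inj_in_uniq ?enum_uniq // => x y; rewrite !mem_enum.
  move=> /Xi[j pj] /Xi[j' pj']; rewrite /rk pj pj' => jj.
  by apply: posI; rewrite pj pj' jj.
move=> j /mapP[x]; rewrite mem_enum => /Xi[j' pj'] ->.
by rewrite /rk pj' mem_iota /=; exact: posn pj'.
Qed.

(* The walk from [p] towards [q] by unit steps, stopping at [q]. *)
Definition walk (p q j : nat) : nat := maxn (p - j) (minn (p + j) q).

(** All ears are concatenated into one word of letters; [G] embeds compatibly into the rail of that
    word, and the rail is zipped into the bus. *)
Lemma tww_atmost_ears t (G : trigraph) (P : {set {set G}}) n pos :
  3 <= t -> 0 < #|G| -> 0 < #|C| -> tww_atmost t C ->
  (forall x, red_deg x + (#|[set i | a i == x]| + #|[set i | b i == x]|) <= t)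
    ->
  (forall i, #|C| <= n i) -> (forall i, 1 < n i) ->
  ear_layout P n pos -> tww_atmost t.+1 G.
Proof.
move=> t3 G_gt0 C_gt0 [s st] Ct nC n_gt1 [posI posn posE posB _].
have [r [rI rC busC]] := bus_order t3 st.
(* Each ear receives a block of the common length [D], so blocks do not overlap; places beyond the
   ear are padding. *)
pose D := \max_i n i.
have nD i : n i <= D := leq_bigmax i.
(* The letters walk from the bus position of [a i] to that of [b i]. As [1 < n i], the two tests for
   the ends never hold together. *)
pose letter i j : nat * option C :=
  (walk (r (a i)) (r (b i)) j,
   if j == 0 then Some (a i) else if j.+1 == n i then Some (b i) else None).
pose letter_at q : nat * option C :=
  if [pick i : I | enum_rank i == q %/ D :> nat] is Some i then letter i (q %%
    D)
  else (0, None).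
pose idx (i : I) j := enum_rank i * D + j.
have idxE i j : j < n i -> letter_at (idx i j) = letter i j.
  move=> jn; have jD : j < D := leq_trans jn (nD i).
  rewrite /letter_at /idx divnMDl ?(leq_trans _ jD) // divn_small // addn0.
  rewrite modnMDl modn_small //; case: pickP => [i1 /eqP i1E|/(_ i)];
    last by rewrite eqxx.
  by rewrite (enum_rank_inj (val_inj i1E)).
pose w := mkseq letter_at (#|I| * D).
have w_size : size w = #|I| * D by rewrite size_mkseq.
have idx_lt i j : j < n i -> idx i j < size w.
  move=> jn; have jD : j < D := leq_trans jn (nD i).
  rewrite w_size /idx; apply: (@leq_trans ((enum_rank i).+1 * D)).
    by rewrite mulSnr ltn_add2l.
  by rewrite leq_mul2r ltn_ord orbT.
have walk_lt p q m j : p < m -> q < m -> walk p q j < m by rewrite /walk; lia.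
have w_ok : all (letter_ok #|C|.-1 r) w.
  apply/allP => l /mapP[q _ ->]; rewrite /letter_at; case: pickP => [i _|//].
  rewrite /letter_ok /=; apply/andP; split.
    by rewrite -ltnS prednK // walk_lt.
  case: eqP => [->|_]; first by apply/eqP; rewrite /walk; lia.
  (* Bus positions are below [#|C|], and [#|C| <= n i], so the walk has reached [r (b i)] by its
     step [n i - 1]. *)
  case: eqP => // qE; apply/eqP; have := rC (a i); have := rC (b i).
  by have := nC i; rewrite /walk; lia.
have w_count x : count (fun l : nat * option C => l.2 == Some x) w <=
    #|[set i | a i == x]| + #|[set i | b i == x]|.
  rewrite count_map -size_filter.
  pose s1 := [seq idx i 0 | i <- enum [set i | a i == x]].
  pose s2 := [seq idx i (n i).-1 | i <- enum [set i | b i == x]].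
  have -> : #|[set i | a i == x]| + #|[set i | b i == x]| = size (s1 ++ s2).
    by rewrite size_cat !size_map -!cardE.
  apply: uniq_leq_size; first by rewrite filter_uniq ?iota_uniq.
  move=> q; rewrite mem_filter => /andP[/= + _]; rewrite mem_cat /letter_at.
  case: pickP => [i /eqP iE|//] /=.
  have qE : q = idx i (q %% D) by rewrite /idx iE -divn_eq.
  have [q0 /eqP[aE]|_] := eqVneq (q %% D) 0.
    by apply/orP; left; apply/mapP; exists i; rewrite ?mem_enum ?inE ?aE // -q0.
  have [qn /eqP[bE]|//] := eqVneq (q %% D).+1 (n i).
  by apply/orP; right; apply/mapP; exists i; rewrite ?mem_enum ?inE ?bE // -qn.
(* Hanging the word on bus vertex 0 is an arbitrary choice: if the first letter is not close to it,
   the rail simply has no edge there. *)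
have railC := tww_atmost_rail 0 t3 rI C_gt0 w_ok
  (fun x => leq_trans (leq_add (leqnn _) (w_count x)) (Ct x)) busC.
(* The default [inr (inl ord0)] is never taken, by [idx_lt]. *)
pose f (x : G) : rail #|C|.-1 r 0 w :=
  match pos x with
  | inl c => inl c
  | inr (i, j) => if insub (idx i j) is Some o then inr (inr o) else inr (inl
    ord0)
  end.
have fP x : (exists2 c, pos x = inl c & f x = inl c) \/
    exists i j (o : 'I_(size w)), [/\ pos x = inr (i, j), j < n i,
      o = idx i j :> nat, nth (0, None) w o = letter i j & f x = inr (inr o)].
  rewrite /f; case px: (pos x) => [c|[i j]]; first by left; exists c.
  have jn := posn _ _ _ px; right; exists i, j.
  case: insubP => [o _ oE|/negP[]]; last exact: idx_lt.
  by exists o; split=> //; rewrite nth_mkseq oE ?idxE // -w_size idx_lt.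
apply: (tww_atmost_compat_inj railC (g := f)) => //.
- apply: compat_to_tailed => x y.
    move=> /posE; case: (fP x) => [[c -> ->]|[i [j [o [-> jn oE on ->]]]]];
    case: (fP y) => [[d -> ->]|[i' [j' [o' [-> jn' oE' on' ->]]]]] /=.
    + by right.
    + rewrite on' /=; case/orP=> /andP[/eqP jE /eqP aE]; first by rewrite jE aE.
      by have [j0|_] := eqVneq j' 0; [have := n_gt1 i'; lia|rewrite jE eqxx aE].
    + rewrite on /=; case/orP=> /andP[/eqP jE /eqP aE]; first by rewrite jE aE.
      by have [j0|_] := eqVneq j 0; [have := n_gt1 i; lia|rewrite jE eqxx aE].
    + rewrite on on' /= => /andP[/eqP iE] jj; subst i'.
      have [jE|jE] : j.+1 = j' \/ j'.+1 = j by lia.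
        constructor 2; rewrite oE oE' /idx -jE addnS eqxx /=.
        by rewrite /close /walk; lia.
      constructor 3; rewrite oE oE' /idx -jE addnS eqxx /=.
      by rewrite /close /walk; lia.
  move=> c d; case: (fP x) => [[c' px ->]|[i [j [o [_ _ _ _ ->]]]]] //.
  case: (fP y) => [[d' py ->]|[i [j [o [_ _ _ _ ->]]]]] // [<-] [<-].
  exact: posB.
- move=> x y; case: (fP x) => [[c px ->]|[i [j [o [px jn oE _ ->]]]]];
    case: (fP y) => [[d py ->]|[i' [j' [o' [py jn' oE' _ ->]]]]] //= [].
    by move=> cd; apply: posI; rewrite px py cd.
  move=> oo; have jD := leq_trans jn (nD i); have jD' := leq_trans jn' (nD i').
  have D_gt0 : 0 < D := leq_trans (ltn0Sn _) jD.
  have oE2 : idx i j = idx i' j' by rewrite -oE -oE' oo.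
  apply: posI; rewrite px py; congr (inr (_, _)).
    apply: enum_rank_inj; apply: val_inj => /=.
    by have := congr1 (divn^~ D) oE2;
      rewrite /idx !divnMDl // !divn_small // !addn0.
  by have := congr1 (modn^~ D) oE2; rewrite /idx !modnMDl !modn_small.
Qed.

End Ears.

(** * Induced subtrigraphs *)

Section Induced.
Variables (G : trigraph) (D : {set G}).

Definition induced : trigraph :=
  @Trigraph {x : G | x \in D} (fun x y => black (val x) (val y))
    (fun x y => red (val x) (val y))
    (fun x y => black_sym (val x) (val y)) (fun x => black_irr (val x))
    (fun x y => red_sym (val x) (val y)) (fun x => red_irr (val x))
    (fun x y => black_red (val x) (val y)).

Lemma tww_atmost_induced k :
  0 < #|D| -> tww_atmost k G -> tww_atmost k induced.
Proof.
move=> D_gt0 Gk; apply: (@tww_atmost_compat_inj k G Gk induced (fun x => val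
  x)).
- by split=> x y //; right.
- exact: val_inj.
- by rewrite card_sig.
Qed.

End Induced.

Lemma card2_setE (T : finType) (A : {set T}) x y :
  #|A| = 2 -> x \in A -> y \in A -> x != y -> A = [set x; y].
Proof.
move=> A2 xA yA xy; apply/esym/eqP; rewrite eqEcard A2 cards2 xy andbT.
by apply/subsetP => z; rewrite !inE => /orP[] /eqP ->.
Qed.

(** * The ears of a tidy graph *)

Section TidyPaths.
Variables (G : trigraph) (H : {set G}) (P : {set {set G}}).
Implicit Types (u v w x y z : G) (X : {set G}).
Hypothesis tidyG : tidy_HP_graph H P.
Hypothesis long_paths : forall X : {set G}, X \in P -> 0 < path_length X.

Definition core : {set G} :=
  [set x in H | [forall z in cover P, ~~ adj x z]].

(** Degree 2 leaves an inner vertex no neighbour off the path and each of the two ends exactly one.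
    At this stage [u] and [v] may coincide. *)
Lemma tidy_path_neighbors X x p :
  0 < path_length X -> induced_path (x :: p) -> X = [set y in x :: p] ->
  {in X, forall y, deg y = 2} ->
  exists u v : G, [/\ u \notin X, v \notin X, adj x u, adj (last x p) v
    & forall y z, y \in X -> z \notin X -> adj y z ->
        (y = x /\ z = u) \/ (y = last x p /\ z = v)].
Proof.
move=> X_gt0 [s_uniq s_adj] XE deg2; set s := x :: p in s_uniq s_adj XE.
have Xs y : (y \in X) = (y \in s) by rewrite XE inE.
have s_size : 1 < size s.
  by move: X_gt0; rewrite /path_length XE cardsE (card_uniqP s_uniq); lia.
have nth_adj j : j.+1 < size s -> adj (nth x s j) (nth x s j.+1).
  by move=> js; rewrite s_adj ?mem_nth ?(ltnW js) // !index_uniq ?eqxx // ltnW.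
have nthX j : j < size s -> nth x s j \in X by move=> js; rewrite Xs mem_nth.
have lastE : last x p = nth x s (size s).-1 by rewrite nth_last.
have other y z : y \in X -> z \in X -> adj y z ->
    (forall z', z' \in X -> adj y z' -> z' = z) ->
    exists2 w, w \notin X & [set z | adj y z] = [set z; w].
  move=> yX zX yz z_uniq; have := deg2 _ yX; rewrite /deg => N2.
  have /card_gt0P[w] : 0 < #|[set z | adj y z] :\ z|.
    by have := cardsD1 z [set z | adj y z]; rewrite N2 inE yz; lia.
  rewrite !inE => /andP[wz yw]; exists w.
    by apply: contra wz => wX; apply/eqP; exact: z_uniq.
  by apply: card2_setE; rewrite ?inE // eq_sym.
have [u uX Nx] : exists2 w, w \notin X & [set z | adj x z] = [set nth x s 1; w].
  apply: other; rewrite ?nthX //; first by rewrite Xs inE eqxx.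
    exact: (nth_adj 0).
  move=> z; rewrite Xs => zs; have ix : index x s = 0 by rewrite /= eqxx.
  by rewrite s_adj ?inE ?eqxx // ix orbF => /eqP <-; rewrite nth_index.
have [v vX Nl] : exists2 w, w \notin X &
    [set z | adj (last x p) z] = [set nth x s (size s).-2; w].
  have l1 : (size s).-1 < size s by rewrite prednK // ltnW.
  have l2 : (size s).-2 < size s by lia.
  apply: other; rewrite ?lastE ?nthX //.
    have lE : (size s).-2.+1 = (size s).-1 by lia.
    by rewrite adj_sym -lE nth_adj // lE.
  move=> z; rewrite Xs => zs; rewrite s_adj ?mem_nth // index_uniq //.
  have zs' : index z s < size s by rewrite index_mem.
  case/orP=> /eqP zE; first by move: zE zs'; lia.
  by rewrite -(nth_index x zs); congr nth; lia.
exists u, v; split=> //.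
- by have /[!inE] : u \in [set z | adj x z] by rewrite Nx !inE eqxx orbT.
- by have /[!inE] : v \in [set z | adj (last x p) z] by rewrite Nl !inE eqxx
    orbT.
move=> y z yX zX yz.
have ys : y \in s by rewrite -Xs.
have jy : index y s < size s by rewrite index_mem.
have yE : nth x s (index y s) = y by rewrite nth_index.
have [j0|jN0] := eqVneq (index y s) 0.
  left; have yx : y = x by rewrite -yE j0.
  split=> //; have : z \in [set z | adj x z] by rewrite inE -yx.
  rewrite Nx !inE => /orP[/eqP zE|/eqP //].
  by move: zX; rewrite zE nthX.
have [jl|jNl] := eqVneq (index y s) (size s).-1.
  right; have yl : y = last x p by rewrite lastE -jl.
  split=> //; have : z \in [set z | adj (last x p) z] by rewrite inE -yl.
  rewrite Nl !inE => /orP[/eqP zE|/eqP //].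
  by move: zX; rewrite zE nthX //; lia.
have j1 : (index y s).-1 < size s by lia.
have j2 : (index y s).+1 < size s by lia.
have Ny : [set z | adj y z] = [set nth x s (index y s).-1;
  nth x s (index y s).+1].
  apply: card2_setE; [exact: deg2| | |].
  - rewrite inE adj_sym -{2}yE; have := nth_adj (index y s).-1.
    by rewrite prednK ?lt0n //; apply.
  - by rewrite inE -{1}yE nth_adj.
  - by rewrite nth_uniq //; lia.
have : z \in [set z | adj y z] by rewrite inE.
by rewrite Ny !inE => /orP[] /eqP zE; move: zX; rewrite zE nthX.
Qed.

Lemma in_H_or_cover y : (y \in H) || (y \in cover P).
Proof.
by have [[_ _ [HP _] _ _] _] := tidyG; have := in_setT y; rewrite -HP inE.
Qed.

Lemma in_H_notin_cover y : y \in H -> y \notin cover P.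
Proof.
have [[_ _ [_ HP] _ _] _] := tidyG => yH; apply/negP => yP.
by move: HP; rewrite disjoint_subset => /subsetP/(_ y yH); rewrite inE yP.
Qed.

Lemma sub_cover X y : X \in P -> y \in X -> y \in cover P.
Proof. by move=> XP yX; apply/bigcupP; exists X. Qed.

Lemma outside_in_H X y z : X \in P -> y \in X -> z \notin X -> adj y z -> z \in
  H.
Proof.
move=> XP yX zX yz; case/orP: (in_H_or_cover z) => // /bigcupP[Y YP zY].
have [[_ _ _ _ [_ sep]] _] := tidyG.
have XY : X != Y by apply: contraNneq zX => ->.
by have := sep _ _ XP YP XY _ _ yX zY; rewrite yz.
Qed.

(** Tidiness speaks of ends of paths; [z] is one, because inner vertices have no neighbour off their
    path. *)
Lemma connector_black_deg u z : u \in H -> z \in cover P -> adj u z ->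
  black_deg u = 0.
Proof.
move=> uH zP uz; have conn : connector H P u by split=> //; exists z.
case/bigcupP: zP => X XP zX;
  have [_ /(_ X XP)[x [p [ip XE _ deg2 ends]]]] := tidyG.
have [u1 [v1 [_ _ _ _ out]]] := tidy_path_neighbors (long_paths XP) ip XE deg2.
have uX : u \notin X by apply: contraL uH => /(sub_cover XP); apply: contraL;
  exact: in_H_notin_cover.
have zx : z \in [:: x; last x p].
  by have [|[-> _]|[-> _]] := out z u zX uX;
    rewrite ?inE ?eqxx ?orbT // adj_sym.
by have [] := ends u z conn zx uz.
Qed.

(* [es] consists of the path [X] and of the connectors at both its ends. *)
Definition ear (X : {set G}) (es : seq G) (a b : G) : Prop :=
  [/\ uniq es /\ 1 < size es,
      forall y z, y \in es -> adj y z ->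
        [\/ z \in es /\ (((index y es).+1 == index z es) || ((index z es).+1 ==
          index y es)),
            index y es = 0 /\ z = a | (index y es).+1 = size es /\ z = b],
      {subset X <= es} /\ (forall y, y \in es -> y \in X \/
        [/\ y \in H, exists2 z, z \in X & adj y z &
            forall z, z \in cover P -> adj y z -> z \in X]),
      a \in core /\ b \in core
    & red a (nth a es 0) /\ red b (nth b es (size es).-1)].

(** The path is flanked by its outer neighbours [u] and [v], whose unique neighbours in [H] are [a]
    and [b]. As connectors have black degree 0, the attaching edges are red. *)
Lemma ear_exists X : X \in P -> exists es a b, ear X es a b.
Proof.
move=> XP; have [_ /(_ X XP)[x [p [ip XE _ deg2 ends]]]] := tidyG.
have [u [v [uX vX xu lv out]]] := tidy_path_neighbors (long_paths XP) ip XE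
  deg2.
have [s_uniq s_adj] := ip; set s := x :: p in s_uniq s_adj XE.
have Xs y : (y \in X) = (y \in s) by rewrite XE inE.
have s_size : 1 < size s.
  by move: (long_paths XP); rewrite /path_length XE cardsE (card_uniqP s_uniq);
    lia.
have xX : x \in X by rewrite Xs inE eqxx.
have lX : last x p \in X by rewrite Xs mem_last.
have ends' w y : w \notin X -> adj y w -> y \in X -> y \in [:: x; last x p] ->
    [/\ w \in H, black_deg w = 0, forall z, z \in cover P -> adj w z -> z = y
      & exists2 w', w' \in core & forall z, z \in H -> adj w z = (z == w')].
  move=> wX yw yX y_end; have wH := outside_in_H XP yX wX yw.
  have wy : adj w y by rewrite adj_sym.
  have yP := sub_cover XP yX.
  have [|w0 wP [w' w'E w'_black]] := ends w y _ y_end wy; first by split=> //;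
    exists y.
  have w'E' z : z \in H -> adj w z = (z == w').
    by move=> zH; rewrite -in_set1 -w'E inE zH.
  have w'H : w' \in H.
    by have : w' \in [set w'] := set11 w'; rewrite -w'E inE => /andP[].
  split=> //.
    by move=> z zP wz; apply/set1P; rewrite -wP inE zP.
  (* A vertex of [H] adjacent to a path has black degree 0, whereas [w'] has positive black degree;
     hence [w'] is in the core. *)
  exists w' => //; rewrite inE w'H; apply/forallP => z; apply/implyP => zP.
  by apply/negP => /(connector_black_deg w'H zP) w'0; rewrite w'0 in w'_black.
have [uH u0 uP [a a_core aE]] := ends' u x uX xu xX (mem_head _ _).
have l_end : last x p \in [:: x; last x p] by rewrite !inE eqxx orbT.
have [vH v0 vP [b b_core bE]] := ends' v (last x p) vX lv lX l_end.
have xl : x != last x p.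
  have <- : nth x s 0 = x by []; rewrite -[last x p]/(last x s).
  by rewrite -(nth_last x s) nth_uniq //; lia.
(* A connector has a single neighbour on the paths, so it cannot serve both ends. *)
have uv : u != v.
  apply: contraNneq xl => uvE; apply/eqP; apply: vP; first exact: sub_cover xX.
  by rewrite -uvE adj_sym.
pose es := u :: rcons s v.
have es_size : size es = (size s).+2 by rewrite /= size_rcons.
have mem_es y : (y \in es) = [|| y == u, y == v | y \in s].
  by rewrite inE mem_rcons inE.
have es_uniq : uniq es.
  by rewrite /es cons_uniq rcons_uniq s_uniq mem_rcons inE negb_or uv -!Xs uX
    vX.
have idx_u : index u es = 0 by rewrite /= eqxx.
have idx_s y : y \in s -> index y es = (index y s).+1.
  move=> ys; rewrite /es -[index _ _]/(if u == y then 0 else (index y (rcons s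
    v)).+1).
  by rewrite ifN -?cats1 ?index_cat ?ys //; apply: contraNneq uX => ->;
    rewrite Xs.
have idx_v : index v es = (size s).+1.
  rewrite /es -[index _ _]/(if u == v then 0 else (index v (rcons s v)).+1).
  by rewrite (negPf uv) -cats1 index_cat -Xs (negPf vX) /= eqxx addn0.
have idx_l : index (last x p) s = (size s).-1.
  by rewrite -[last x p]/(last x s) -(nth_last x s) index_uniq //; lia.
have in_core_H c : c \in core -> c \in H by rewrite inE => /andP[].
have adj_red w w' : black_deg w = 0 -> adj w w' -> red w' w.
  move=> w0; case/orP=> [ww'|]; last by rewrite red_sym.
  by move/eqP: w0; rewrite cards_eq0 => /eqP/setP/(_ w'); rewrite !inE ww'.
exists es, a, b; split.
- by rewrite es_size.
- move=> y z; rewrite mem_es => /or3P[/eqP ->|/eqP ->|ys] yz.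
  + case/orP: (in_H_or_cover z) => [zH|zP].
      by constructor 2; split=> //; apply/eqP; rewrite -aE.
    constructor 1; rewrite (uP z zP yz) mem_es inE eqxx !orbT idx_u idx_s ?inE
      ?eqxx //.
    by rewrite /= eqxx.
  + case/orP: (in_H_or_cover z) => [zH|zP].
      by constructor 3; split; [rewrite idx_v es_size|apply/eqP; rewrite -bE].
    constructor 1; rewrite (vP z zP yz) mem_es -Xs lX !orbT idx_v idx_s -?Xs //
      idx_l.
    by rewrite prednK ?eqxx ?orbT // ltnW.
  + constructor 1; rewrite mem_es; have [zs|zs] := boolP (z \in s).
      rewrite !orbT !idx_s // !eqSS; split=> //.
      by move: yz; rewrite s_adj // eq_sym [index y s == _]eq_sym.
    have [|||[yE zE]|[yE zE]] := out y z; rewrite ?Xs // zE.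
      rewrite eqxx idx_u idx_s // yE /= eqxx; split=> //.
    rewrite eqxx orbT idx_v idx_s // yE idx_l prednK ?eqxx //; lia.
- split=> [y|y]; first by rewrite Xs mem_es => ->; rewrite !orbT.
  rewrite mem_es => /or3P[/eqP ->|/eqP ->|ys]; last by left; rewrite Xs.
    right; split=> //; first by exists x => //; rewrite adj_sym.
    by move=> z zP /uP -> .
  right; split=> //; first by exists (last x p) => //; rewrite adj_sym.
  by move=> z zP /vP -> .
- by [].
- split; first by rewrite /= adj_red // aE ?eqxx // in_core_H.
  have -> : nth b es (size es).-1 = v.
    by rewrite es_size /= nth_rcons ltnn eqxx.
  by rewrite adj_red // bE ?eqxx // in_core_H.
Qed.

(** Ears are indexed by the paths. The degree bound holds because the red neighbours of [x] in the
    core and the ear ends attached to [x] are distinct red neighbours of [x] in [G]. *)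
Lemma tidy_ear_layout t : (forall x : G, red_deg x <= t) ->
  exists (I : finType) (a b : I -> induced core),
    (exists n pos, ear_layout a b P n pos) /\
    (forall x : induced core,
       red_deg x + (#|[set i | a i == x]| + #|[set i | b i == x]|) <= t).
Proof.
move=> Gt; pose I : finType := {X : {set G} | X \in P}.
have [es [a [b es_ear]]] : exists (es : I -> seq G) (a b : I -> induced core),
    forall i, ear (val i) (es i) (val (a i)) (val (b i)).
  have /boolp.choice[f fP] : forall i : I,
      exists q : seq G * induced core * induced core,
        ear (val i) q.1.1 (val q.1.2) (val q.2).
    move=> i; have [s [a [b iE]]] := ear_exists (valP i).
    have [_ _ _ [ac bc] _] := iE.
    by exists (s, Sub a ac, Sub b bc).
  by exists (fun i => (f i).1.1), (fun i => (f i).1.2), (fun i => (f i).2).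
have es_core y i : y \in es i -> y \notin core.
  move=> yi; have [_ _ [_ es_mem] _ _] := es_ear i.
  case: (es_mem y yi) => [yX|[_ [z zX yz] _]]; apply/negP;
    rewrite inE => /andP[yH].
    by have := in_H_notin_cover yH; rewrite (sub_cover (valP i) yX).
  by move/forallP/(_ z); rewrite (sub_cover (valP i) zX) yz.
(* Ears are disjoint: the paths are, and all neighbours of a connector on paths lie on one path. *)
have es_inj y i i' : y \in es i -> y \in es i' -> i = i'.
  have XX z (j j' : I) : z \in val j -> z \in val j' -> j = j'.
    move=> zj zj'; apply: val_inj; have [[_ _ _ _ [triv _]] _] := tidyG.
    by rewrite -(def_pblock triv (valP j) zj) -(def_pblock triv (valP j') zj').
  have aux (j j' : I) : y \in val j -> y \in es j' -> j = j'.
    move=> yj yj'; have [_ _ [_ es_mem] _ _] := es_ear j'.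
    case: (es_mem y yj') => [|[yH _ _]]; first exact: XX.
    by have := in_H_notin_cover yH; rewrite (sub_cover (valP j) yj).
  move=> yi yi'; have [_ _ [_ es_mem] _ _] := es_ear i.
  case: (es_mem y yi) => [yX|[yH [z zX yz] _]]; first exact: aux.
  have [_ _ [_ es_mem'] _ _] := es_ear i'.
  case: (es_mem' y yi') => [yX'|[_ _ /(_ z (sub_cover (valP i) zX) yz)]];
    first exact/esym/aux.
  exact: XX.
pose spec y (q : induced core + I * nat) := match q with
  | inl c => val c = y
  | inr (i, j) => y \in es i /\ j = index y (es i) end.
have core_adj c i y : c \in core -> y \in es i -> adj y c ->
    (index y (es i) = 0 /\ c = val (a i)) \/
    ((index y (es i)).+1 = size (es i) /\ c = val (b i)).
  move=> cc yi yc; have [_ E _ _ _] := es_ear i.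
  case: (E y c yi yc) => [[ci _]||]; [|by left|by right].
  by have := es_core _ _ ci; rewrite cc.
have /boolp.choice[pos posP] : forall y, exists q, spec y q.
  move=> y; have [yc|yc] := boolP (y \in core);
    first by exists (inl (Sub y yc)).
  case/orP: (in_H_or_cover y) => [yH|/bigcupP[X XP yX]]; last first.
    have [_ _ [Xes _] _ _] := es_ear (Sub X XP).
    exists (inr (Sub X XP, index y (es (Sub X XP)))); split=> //.
    exact: Xes.
  (* A vertex of [H] outside the core is adjacent to some [z] on a path, and every neighbour of [z]
     lies in the ear of that path or in the core. *)
  move: yc; rewrite inE yH negb_forall => /existsP[z].
  rewrite negb_imply negbK => /andP[/bigcupP[X XP zX] yz].
  pose i : I := Sub X XP.
  have [_ E [Xes _] [ac bc] _] := es_ear i.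
  exists (inr (i, index y (es i))); split=> //.
  have zP := sub_cover XP zX.
  have core_no c : c \in core -> y <> c.
    by rewrite inE => /andP[_ /forallP/(_ z)]; rewrite zP /= => + yE;
      rewrite -yE yz.
  have zy : adj z y by rewrite adj_sym.
  case: (E z y (Xes _ zX) zy) => [[//]|[_ yE]|[_ yE]];
    by have := core_no _ _ yE; case.
exists I, a, b; split.
  exists (fun i => size (es i)), pos; split.
  - move=> y z yz; have := posP y; have := posP z; rewrite -yz.
    case: (pos y) => [c <- //|[i j]] /= [zi ->] [yi ji].
    by rewrite -(nth_index y yi) -ji nth_index.
  - by move=> y i j yE; have := posP y; rewrite yE => -[yi ->];
      rewrite index_mem.
  - have inlr y z c i j : adj y z -> spec y (inl c) -> spec z (inr (i, j)) ->
        ear_edge a b (fun i => size (es i)) (inl c) (inr (i, j)).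
      move=> yz /= cy [zi ->]; rewrite -cy adj_sym in yz.
      case: (core_adj _ _ _ (valP c) zi yz) => -[-> /val_inj ->];
        rewrite !eqxx ?orbT //.
    move=> y z yz; have := posP y; have := posP z.
    case: (pos y) (pos z) => [c|[i j]] [d|[i' j']].
    + by move=> /= dz cy; rewrite -cy -dz in yz.
    + by move=> dz cy; exact: inlr yz cy dz.
    + by move=> dz cy; rewrite ear_edge_sym; apply: inlr dz cy; rewrite adj_sym.
    + move=> /= [zi' ->] [yi ->]; have [_ E _ [ac bc] _] := es_ear i.
      case: (E y z yi yz) => [[zi zy]|[_ zE]|[_ zE]].
      * by rewrite -(es_inj _ _ _ zi zi') eqxx.
      * by have := es_core _ _ zi'; rewrite zE ac.
      * by have := es_core _ _ zi'; rewrite zE bc.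
  - move=> y z c d yc zd; have := posP y; have := posP z.
    by rewrite yc zd /= => <- <-.
  - have in_i (i : I) : in_ear pos i (val i).
      move=> y yi; have [_ _ [Xes _] _ _] := es_ear i.
      have := posP y; case: (pos y) => [c cy|[i' j] [yi' _]].
        by have := es_core _ _ (Xes _ yi); rewrite -cy (valP c).
      by exists j; rewrite (es_inj _ _ _ (Xes _ yi) yi').
    split=> [X XP|i]; first by exists (Sub X XP); exact: (in_i (Sub X XP)).
    by exists (val i); [exact: valP|exact: in_i].
move=> x; apply: leq_trans (Gt (val x)).
pose hd i := nth (val (a i)) (es i) 0.
pose lt i := nth (val (b i)) (es i) (size (es i)).-1.
have es_gt1 i : 1 < size (es i) by have [[]] := es_ear i.
have hdP i : hd i \in es i by rewrite mem_nth // ltnW.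
have lt_size i : (size (es i)).-1 < size (es i) by rewrite prednK // ltnW.
have ltP i : lt i \in es i by rewrite mem_nth.
pose s1 := [seq val c | c <- enum [set c : induced core | red x c]].
pose s2 := [seq hd i | i <- enum [set i | a i == x]].
pose s3 := [seq lt i | i <- enum [set i | b i == x]].
have -> : red_deg x + (#|[set i | a i == x]| + #|[set i | b i == x]|) =
    size (s1 ++ (s2 ++ s3)).
  by rewrite !size_cat !size_map -!cardE.
rewrite /red_deg cardE; apply: uniq_leq_size.
  rewrite cat_uniq cat_uniq !map_inj_in_uniq ?enum_uniq //=.
  - rewrite andbT; apply/andP; split; apply/hasPn => z.
      rewrite mem_cat => zs; apply/mapP => -[c _ zE].
      have [i zi] : exists i, z \in es i.
        by case/orP: zs => /mapP[i _ ->]; exists i.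
      by have := es_core _ _ zi; rewrite zE (valP c).
    (* The first and last vertices of one ear differ since it has at least two vertices; those of
       different ears differ by disjointness. *)
    case/mapP=> i _ ->; apply/mapP => -[i' _ hlE].
    have ii' : i = i' by apply: (es_inj (lt i)); rewrite ?ltP // hlE hdP.
    move: hlE; rewrite -ii' /hd /lt; have [[es_uniq _] _ _ _ _] := es_ear i.
    rewrite (set_nth_default (val (a i)) (val (b i))) //.
    move/eqP; rewrite nth_uniq // ?(ltnW (es_gt1 i)) //.
    by case: (size _) (es_gt1 i) => [|[]].
  - by move=> i i' _ _ iE; apply: (es_inj (lt i)); rewrite ?ltP // iE ltP.
  - by move=> i i' _ _ iE; apply: (es_inj (hd i)); rewrite ?hdP // iE hdP.
  - by move=> c d _ _; exact: val_inj.
move=> z; rewrite !mem_cat mem_enum inE => /or3P[] /mapP[i];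
  rewrite mem_enum inE.
- by move=> + ->.
- by move=> /eqP <- ->; have [_ _ _ _ []] := es_ear i.
- by move=> /eqP <- ->; have [_ _ _ _ []] := es_ear i.
Qed.

End TidyPaths.

(** * The length bound and the conclusion *)

(** The first bound gives ears enough vertices to walk along the whole bus, as the core lies in [H];
    the second keeps the two ends of an ear apart. *)
Lemma min_length_bounds (G : trigraph) (H : {set G}) :
  #|H| <= min_length H /\ 1 < min_length H.
Proof.
rewrite /min_length; split; last by lia.
have [->//|H_gt0] := posnP #|H|.
rewrite /fH; set h := #|H| in H_gt0 *.
suff : h <= (3 ^ (h + 4) * h ^ 2) ^ (2 * h ^ 2) by lia.
have h3 : h <= 3 ^ (h + 4).
  by apply: leq_trans (ltnW (ltn_expl h (isT : 1 < 3))) _;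
    rewrite leq_pexp2l // leq_addr.
have h2 : 0 < h ^ 2 by rewrite expn_gt0 H_gt0.
apply: leq_trans h3 (leq_trans (leq_pmulr _ h2) _).
rewrite -{1}[_ * _]expn1 leq_pexp2l //; first by rewrite muln_gt0 expn_gt0.
by rewrite muln_gt0.
Qed.

Theorem theorem43 (G : trigraph) (H : {set G}) (P : {set {set G}})
    (G' : trigraph) (P' : {set {set G'}}) :
  tidy_HP_graph H P ->
  3 <= tww G ->
  (forall X : {set G}, X \in P -> min_length H <= path_length X) ->
  shortening P' P ->
  (forall X : {set G'}, X \in P' -> min_length H <= path_length X) ->
  tww G' <= tww G + 1.
Proof.
move=> tidyG G3 longG short longG'.
have [[[G_gt0 _] _ _ _ _] _] := tidyG.
have [min_card min_gt1] := min_length_bounds H.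
have [[s sE] _] := tww_spec G_gt0.
have Gk : tww_atmost (tww G) G by exact/tww_atmostP.
have Gt (x : G) : red_deg x <= tww G.
  by apply: leq_trans (leq_bigmax x) _; rewrite -sE; exact: max_red_deg_width.
have long_gt0 (X : {set G}) : X \in P -> 0 < path_length X.
  by move=> /longG; apply: leq_trans; exact: ltnW.
have [I [a [b [[n [pos lay]] deg_t]]]] := tidy_ear_layout tidyG long_gt0 Gt.
(* Any vertex is in the core or on an ear, and ears are attached to core vertices. *)
have core_gt0 : 0 < #|core H P|.
  have /card_gt0P[y _] := G_gt0.
  apply/card_gt0P; case: (pos y) => [c|[i _]]; first by exists (val c);
    exact: valP.
  by exists (val (a i)); exact: valP.
have [G'_gt0 [n' [pos' lay']]] := ear_layout_shortening short G_gt0 lay.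
(* The successor appears because a path has one more vertex than edges. *)
have n'H i : (min_length H).+1 <= n' i.
  have [X XP] := ear_layout_card i lay'; apply: leq_trans.
  by move: (longG' X XP) min_gt1; rewrite /path_length; lia.
apply/tww_atmostP => //; rewrite addn1.
apply: (tww_atmost_ears G3 G'_gt0 _ _ deg_t _ _ lay').
- by rewrite card_sig.
- exact: tww_atmost_induced.
- move=> i; apply: leq_trans (n'H i); apply: leqW; apply: leq_trans min_card.
  rewrite card_sig; apply: subset_leq_card; apply/subsetP => x.
  by rewrite !inE => /andP[].
- by move=> i; apply: leq_trans (n'H i); exact: leqW.
Qed.
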